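(* For every $r \in \mathbb{N}$, $$\lim_{n \to \infty} \rho(U_{r,n}) = \frac{F_{r-1}}{2^{r-2}},$$ where $F_i$ is the $i$-th ordered Bell number and, for an oriented matroid $M$, $\rho(M) = \dfrac{f_{total}(\mathscr{T}_{S^0} M)}{f_{total}(\mathscr{S} M)}$ is the ratio of the total number of faces of the Engström representation of (the underlying matroid of) $M$ indexed by $S^0$ to that of the Folkman–Lawrence representation of $M$.
   Context: $F_i=\sum_{k=0}^i k!\,S(i,k)$ is the $i$-th ordered Bell (Fubini) number, with $S(i,k)$ the Stirling number of the second kind. $U_{r,n}$ is the uniform matroid of rank $r$ on $[n]=\{1,\dots,n\}$ (its flats are $[n]$ and all subsets of size less than $r$); in $\mathscr{S}U_{r,n}$ and $\rho(U_{r,n})$ it stands for any oriented matroid whose underlying matroid is $U_{r,n}$. For a finite CW complex $\Delta$, $f_{total}(\Delta)$ is the total number of faces of $\Delta$ including the empty face, i.e. $1$ plus the number of cells. Folkman–Lawrence representation. An oriented matroid $M$ on a finite set $E$ is given by its set of covectors $\mathcal{L}\subseteq\{+,0,-\}^E$ (satisfying the usual covector axioms), ordered componentwise by $0<+$, $0<-$; its underlying matroid has as flats the zero sets $\{e: X_e=0\}$, $X\in\mathcal{L}$. If $M$ has rank $r$, $\mathscr{S}M$ is the regular cell decomposition of the sphere $S^{r-1}$ whose face poset (including the empty face, corresponding to the zero covector) is isomorphic to $\mathcal{L}$. Thus $f_{total}(\mathscr{S}M)=|\mathcal{L}|$. Engström representation with $X=S^0$ (two points). For a matroid $M$ of rank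 $r$, $L(M)$ is its lattice of flats ordered by inclusion, $\operatorname{corank}(p)=r-\operatorname{rk}(p)$, $\Delta(P)$ is the order complex of a poset $P$, and $L(M)_{\le p}=\{q\in L(M): q\le p\}$. For $p\in L(M)$ let $D(p)$ be the join of $\operatorname{corank}(p)$ copies of $S^0$, indexed by $\{1,\dots,\operatorname{corank}(p)\}$ (the empty join is the empty space), with the standard cell structure of a join. For $p\ge q$ let $d_{pq}:D(p)\to D(q)$ be the inclusion induced by $\{1,\dots,\operatorname{corank}(p)\}\subseteq\{1,\dots,\operatorname{corank}(q)\}$. Then $$\mathscr{T}_{S^0} M = \coprod_{p\in L(M)} \bigl(\Delta(L(M)_{\le p})\times D(p)\bigr)\big/\sim,$$ where $\sim$ is the equivalence relation generated by: for $(a,x)\in\Delta(L(M)_{\le p})\times D(p)$ and $(b,y)\in\Delta(L(M)_{\le q})\times D(q)$, $(a,x)\sim(b,y)$ if $p\ge q$, $d_{pq}(x)=y$ and $a=b$. It is a CW complex whose open cells are the images of the open product cells $\sigma\times e$ of the spaces $\Delta(L(M)_{\le p})\times D(p)$ (identified cells being counted once).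
   Formalization: The claim is proved for r ≥ 2 only: for r = 0 the number F_{-1} is undefined, and for r = 1 both representations have 3 faces in total, so ρ(U_{1,n}) = 1 for all n ≥ 1, while the formula gives F_0/2^{-1} = 2. *)

(* Defs.v *)
From HB Require Import structures.
From mathcomp Require Import all_boot all_order all_algebra.
From Stdlib Require Import Relations.Relation_Operators.

Set Implicit Arguments.
Unset Strict Implicit.
Unset Printing Implicit Defensive.

Import Order.TTheory GRing.Theory Num.Theory.

(** * Ordered Bell numbers *)

Definition stirling2 (i k : nat) : nat :=
  #|[set P : {set {set 'I_i}} | partition P [set: 'I_i] & #|P| == k]|.

Definition fubini (i : nat) : nat :=
  \sum_(0 <= k < i.+1) k`! * stirling2 i k.

(** * Matroids, given by their flats *)

Section Matroids.
Variable E : finType.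
Implicit Types (L : {set {set E}}) (F G H : {set E}).

Definition covers L F G : bool :=
  (F \proper G) && [forall H in L, ~~ ((F \proper H) && (H \proper G))].

(* Since [L] is closed under intersection, the cover [G] in the last clause is
   unique: the covers of [F] partition the complement of [F]. *)
Definition is_flats L : bool :=
  [&& [set: E] \in L,
      [forall F in L, forall G in L, F :&: G \in L] &
      [forall F in L, forall e in ~: F,
         [exists G in L, (e \in G) && covers L F G]]].

Record matroid := Matroid { flats : {set {set E}}; flatsP : is_flats flats }.

HB.instance Definition _ := [isSub for flats].

(* The chains of a family of sets ordered by inclusion (the empty chain
   included), i.e. the faces of its order complex. *)
Definition order_complex L : {set {set {set E}}} :=
  [set C : {set {set E}} | (C \subset L) &
     [forall F in C, forall G in C, (F \subset G) || (G \subset F)]].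

Variable M : matroid.

Definition flats_below F : {set {set E}} := [set G in flats M | G \subset F].

(* The rank of a flat is its height in the lattice of flats. *)
Definition rk F : nat := (\max_(C in order_complex (flats_below F)) #|C|).-1.

Definition rank : nat := rk [set: E].

Definition corank F : nat := rank - rk F.

End Matroids.

Lemma uniform_is_flats (r n : nat) :
  is_flats [set F : {set 'I_n} | (F == [set: 'I_n]) || (#|F| < r)].
Proof.
apply/and3P; split; first by rewrite inE eqxx.
  apply/forall_inP => F; rewrite inE => hF; apply/forall_inP => G.
  rewrite inE => hG; rewrite inE.
  case/orP: hF => [/eqP -> | hF]; first by rewrite setTI.
  by rewrite (leq_ltn_trans (subset_leq_card (subsetIl F G)) hF) orbT.
apply/forall_inP => F; rewrite inE => hF; apply/forall_inP => e.
rewrite inE => eF.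
have {}hF : #|F| < r.
  by case/orP: hF => // /eqP FT; rewrite FT inE in eF.
have cF : #|e |: F| = #|F|.+1 by rewrite cardsU1 eF.
case: (ltnP #|F|.+1 r) => hr; apply/exists_inP.
  exists (e |: F); first by rewrite inE cF hr orbT.
  rewrite setU11 /covers properUr ?sub1set //=.
  apply/forall_inP => H _; apply/negP => /andP[/proper_card FH /proper_card].
  by rewrite cF ltnS leqNgt FH.
exists [set: 'I_n]; first by rewrite inE eqxx.
rewrite inE /covers properE subsetT /=; apply/andP; split.
  by apply/subsetPn; exists e; rewrite ?inE.
apply/forall_inP => H; rewrite inE => hH; apply/negP => /andP[/proper_card FH].
case/orP: hH => [/eqP -> | hH]; first by rewrite properxx.
by have := leq_trans FH (leq_trans hH hr); rewrite ltnn.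
Qed.

(* For [n < r] this is the free matroid, of rank [n]. *)
Definition uniform_matroid (r n : nat) : matroid 'I_n :=
  Matroid (uniform_is_flats r n).

(** * Oriented matroids, given by their covectors *)

Inductive sign := Neg | Zero | Pos.

Definition sign_to_option (s : sign) : option bool :=
  match s with Neg => Some false | Zero => None | Pos => Some true end.
Definition option_to_sign (o : option bool) : sign :=
  match o with Some false => Neg | None => Zero | Some true => Pos end.
Lemma sign_to_optionK : cancel sign_to_option option_to_sign.
Proof. by case. Qed.
HB.instance Definition _ := Countable.copy sign (can_type sign_to_optionK).
HB.instance Definition _ := Finite.copy sign (can_type sign_to_optionK).

Definition sopp (s : sign) : sign :=
  match s with Neg => Pos | Zero => Zero | Pos => Neg end.

Section OrientedMatroids.
Variable E : finType.
Implicit Types (X Y Z : {ffun E -> sign}).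

Definition zero_vec : {ffun E -> sign} := [ffun=> Zero].
Definition opp_vec X : {ffun E -> sign} := [ffun e => sopp (X e)].
Definition compose X Y : {ffun E -> sign} :=
  [ffun e => if X e == Zero then Y e else X e].
Definition separation X Y : {set E} :=
  [set e | (X e != Zero) && (X e == sopp (Y e))].

Record oriented_matroid := OrientedMatroid {
  covectors : {set {ffun E -> sign}};
  covector0 : zero_vec \in covectors;
  covectorN : forall X, X \in covectors -> opp_vec X \in covectors;
  covectorC : forall X Y, X \in covectors -> Y \in covectors ->
    compose X Y \in covectors;
  covector_elim : forall X Y e, X \in covectors -> Y \in covectors ->
    e \in separation X Y ->
    exists Z, [/\ Z \in covectors, Z e = Zero &
      forall f, f \notin separation X Y ->
        Z f = compose X Y f /\ Z f = compose Y X f] }.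

Definition zero_set X : {set E} := [set e | X e == Zero].

Lemma underlying_is_flats (M : oriented_matroid) :
  is_flats [set zero_set X | X in covectors M].
Proof.
set L := (X in is_flats X).
have cl2 F G : F \in L -> G \in L -> F :&: G \in L.
  move=> /imsetP[X hX ->] /imsetP[Y hY ->]; apply/imsetP.
  exists (compose X Y); first exact: covectorC.
  by apply/setP => e; rewrite !inE ffunE; case: (X e =P Zero) => // /eqP/negPf.
have LT : [set: E] \in L.
  apply/imsetP; exists zero_vec; first exact: covector0.
  by apply/setP => e; rewrite !inE ffunE eqxx.
apply/and3P; split=> //.
  by apply/forall_inP => F hF; apply/forall_inP => G; apply: cl2.
apply/forall_inP => F hF; apply/forall_inP => e; rewrite inE => eF.
pose G := \bigcap_(H in L | e |: F \subset H) H.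
have GL : G \in L by rewrite /G; elim/big_ind: _ => // H /andP[].
have sub_G : e |: F \subset G by apply/bigcapsP => H /andP[].
have eG : e \in G by rewrite (subsetP sub_G) ?setU11.
have FG : F \subset G by apply: subset_trans sub_G; apply: subsetUr.
apply/exists_inP; exists G => //; rewrite eG /= /covers properE FG /=.
apply/andP; split; first by apply/subsetPn; exists e.
apply/forall_inP => H HL; apply/negP => /andP[/properP[FH [f fH fF]] HG].
have eH : e \notin H.
  apply/negP => eH; move: HG; rewrite properE => /andP[_ /negP]; apply.
  by apply: bigcap_inf; rewrite HL subUset sub1set eH FH.
have fG : f \in G by apply: (subsetP (proper_sub HG)).
case/imsetP: hF => X hX FX; case/imsetP: HL => Y hY HY.
have Xf : X f != Zero by move: fF; rewrite FX inE.
have Yf : Y f = Zero by move: fH; rewrite HY inE => /eqP.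
have Ye : Y e != Zero by move: eH; rewrite HY inE.
have XF g : g \in F -> X g = Zero by rewrite FX inE => /eqP.
have YF g : g \in F -> Y g = Zero.
  by move=> /(subsetP FH); rewrite HY inE => /eqP.
have key Z : Z \in covectors M -> Z e = Zero ->
    (forall g, g \in F -> Z g = Zero) -> Z f = Zero.
  move=> hZ Ze ZF; have ZL : zero_set Z \in L by apply: imset_f.
  suff /subsetP/(_ _ fG) : G \subset zero_set Z by rewrite inE => /eqP.
  apply: bigcap_inf; rewrite ZL subUset sub1set inE Ze eqxx /=.
  by apply/subsetP => g /ZF Zg; rewrite inE Zg.
have Xe : X e != Zero by apply: contra Xf => /eqP Xe; apply/eqP/key.
have [Y' [hY' XY' Y'f Y'F]] : exists Y', [/\ Y' \in covectors M,
    e \in separation X Y', Y' f = Zero & forall g, g \in F -> Y' g = Zero].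
  have [XY|XY] := boolP (X e == sopp (Y e)).
    by exists Y; split=> //; rewrite inE Xe XY.
  exists (opp_vec Y); split; first exact: covectorN.
  - by rewrite inE Xe ffunE /=; move: Xe Ye XY; case: (X e); case: (Y e).
  - by rewrite ffunE Yf.
  - by move=> g /YF Yg; rewrite ffunE Yg.
have [Z [hZ Ze ZXY]] := covector_elim hX hY' XY'.
have fS : f \notin separation X Y'.
  by rewrite inE Y'f /= andNb.
have ZF g : g \in F -> Z g = Zero.
  move=> gF; have gS : g \notin separation X Y' by rewrite inE XF.
  by have [-> _] := ZXY g gS; rewrite ffunE XF // eqxx Y'F.
have [Zf _] := ZXY f fS.
by have /eqP := key Z hZ Ze ZF; rewrite Zf ffunE !(negPf Xf).
Qed.

Definition underlying (M : oriented_matroid) : matroid E :=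
  Matroid (underlying_is_flats M).

End OrientedMatroids.

(** * Cells and their number *)

(* Loaded here only, since it shadows many names on finite sets used above. *)
From mathcomp Require Import finmap.
From mathcomp Require Import all_classical all_reals all_analysis.

Local Open Scope ring_scope.

(* Number of faces, the empty one included, of a complex with the given cells;
   meaningful for finite sets only, as [fset_set] is empty otherwise. *)
Definition f_total (C : choiceType) (cells : set C) : nat :=
  (#|` fset_set cells|).+1.

(* The cells of the Folkman-Lawrence representation: its face poset is that of
   the covectors, with the zero covector as the empty face. *)
Definition folkman_lawrence_cells (E : finType) (M : oriented_matroid E) :
    set {ffun E -> sign} :=
  [set X | X \in covectors M /\ X <> zero_vec E]%classic.

Section Realization.
Variables (R : realType) (V : finType).

Definition supp (a : V -> R) : {set V} := [set v | a v != 0].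

(* Geometric realization, in barycentric coordinates, of the abstract simplicial
   complex with set of faces [K]. It is immaterial whether the empty set is in
   [K], as no point has empty support. *)
Definition realization (K : {set {set V}}) : set (V -> R) :=
  [set a | [/\ forall v, 0 <= a v, \sum_v a v = 1 & supp a \in K]]%classic.

Definition open_simplex (s : {set V}) : set (V -> R) :=
  [set a | [/\ forall v, 0 <= a v, \sum_v a v = 1 & supp a = s]]%classic.

End Realization.

Definition S0 : {set {set bool}} := [set s : {set bool} | (#|s| <= 1)%N].

(* The join of the copies of [S0] with index [i < c], as a subcomplex of the
   join of [m] copies. *)
Definition join_S0 (m c : nat) : {set {set 'I_m * bool}} :=
  [set s : {set 'I_m * bool} |
    [forall i : 'I_m, [set b | (i, b) \in s] \in S0] &
    [forall v in s, (v.1 < c)%N]].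

Section Engstrom.
Variables (R : realType) (E : finType) (M : matroid E).

(* A point [(p, a, x)] stands for the point [(a, x)] of the summand of index
   [p]. All the spaces D(p) live in the join of [rank M] copies of S^0, so that
   the maps d_pq are inclusions of subsets. *)
Definition engstrom_point : Type :=
  ({set E} * ({set E} -> R) * ('I_(rank M) * bool -> R))%type.

Definition Dfaces (p : {set E}) : {set {set 'I_(rank M) * bool}} :=
  join_S0 (rank M) (corank M p).

Definition coproduct : set engstrom_point :=
  [set u : engstrom_point | [/\ u.1.1 \in flats M,
     realization (order_complex (flats_below M u.1.1)) u.1.2 &
     realization (Dfaces u.1.1) u.2]]%classic.

Definition engstrom_glue (u v : engstrom_point) : Prop :=
  [/\ coproduct u, coproduct v, v.1.1 \subset u.1.1, u.2 = v.2
    & u.1.2 = v.1.2].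

Definition engstrom_equiv : engstrom_point -> engstrom_point -> Prop :=
  clos_refl_sym_trans engstrom_point engstrom_glue.

(* The quotient map; the points of the quotient are equivalence classes. *)
Definition engstrom_proj (u : engstrom_point) : set engstrom_point :=
  [set v | engstrom_equiv u v]%classic.

Definition engstrom_space : set (set engstrom_point) :=
  (engstrom_proj @` coproduct)%classic.

Definition product_cell (p : {set E}) (s : {set {set E}})
    (e : {set 'I_(rank M) * bool}) : set engstrom_point :=
  [set u : engstrom_point | [/\ u.1.1 = p, open_simplex s u.1.2 &
     open_simplex e u.2]]%classic.

Definition engstrom_cells : set (set (set engstrom_point)) :=
  [set c : set (set engstrom_point) | exists p s e,
    [/\ p \in flats M,
        s \in order_complex (flats_below M p) /\ s != finset.set0,
        e \in Dfaces p /\ e != finset.set0 &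
        c = (engstrom_proj @` product_cell p s e)%classic]]%classic.

Lemma finite_engstrom_cells : finite_set engstrom_cells.
Proof.
pose I := ({set E} * {set {set E}} * {set 'I_(rank M) * bool})%type.
pose f (t : I) := (engstrom_proj @` product_cell t.1.1 t.1.2 t.2)%classic.
apply: (@sub_finite_set _ _ (f @` setT)%classic).
  by move=> c [p [s [e [_ _ _ ->]]]]; exists (p, s, e).
exact/finite_image/finite_finset.
Qed.

End Engstrom.

Arguments engstrom_space R {E} M _.
Arguments engstrom_cells R {E} M _.

Definition rho (R : realType) (E : finType) (M : oriented_matroid E) : R :=
  (f_total (engstrom_cells R (underlying M)))%:R /
  (f_total (folkman_lawrence_cells M))%:R.

(* Main.v *)
Require Import Defs.
From mathcomp Require Import all_boot all_order all_algebra.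
From mathcomp Require Import zify.
From Stdlib Require Import Relations.Relation_Operators.

(** Both face numbers are, for [n >= r], linear combinations of the binomial
coefficients ['C(n, k)] with [k < r] whose weights do not depend on [n]. Since
['C(n, k) / 'C(n, r - 1)] tends to [0] for [k < r - 1], the limit of the ratio
is the ratio of the two weights of ['C(n, r - 1)] ([cvg_bin_sum]).

Engström side. Two points of the coproduct are identified exactly when they have
the same coordinates [(a, x)]: both are glued to the point with these
coordinates in the summand of the top flat of the chain supporting [a], where
it exists because [D(p)] grows when [p] shrinks. So the cells are the pairs of a nonempty chain of
flats with top [p] and a nonempty face of [D(p)], which is a join of [corank p]
pairs of points and has [3 ^ corank p - 1] nonempty faces. In a uniform matroid
the flats below a flat [p] of size [k < r] are all the subsets of [p], and
there are [2 F_k] chains of subsets of [p] with top [p] when [k > 0]: such a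
chain from the empty set to [p] is an ordered partition of [p], and removing the
empty set from the chain gives the factor [2]. The factor [2 F_k] is obtained
by showing that chains and ordered partitions satisfy the same recursion over
the proper subsets of [p] ([card_topped_chains]). At [k = r - 1] the weight is
[2 F_(r-1) (3 - 1)].

Folkman-Lawrence side. The number of covectors of a uniform oriented matroid
depends only on its rank and size. Deleting an element [e] identifies three
covectors whenever a nonzero covector vanishing at [e] is involved and none
otherwise, so that
[f(r, n) = f(r, n-1) + 2 (f(r-1, n-1) - 1)] ([minor_covectors_delete]); with
[f(r, r) = 3 ^ r] this gives
[f(r, n) = 1 + sum_(k < r, r - k odd) 2 ^ (k+1) 'C(n, k)]. At [k = r - 1] the
weight is [2 ^ r], and [4 F_(r-1) / 2 ^ r = F_(r-1) / 2 ^ (r-2)]. *)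

Set Implicit Arguments.
Unset Strict Implicit.
Unset Printing Implicit Defensive.

Import Order.TTheory GRing.Theory Num.Theory.

(** * Recursions over proper subsets *)

Lemma sum_subset_card (T : finType) (B : {set T}) (k : nat) (h : nat -> nat) :
  \sum_(q : {set T} | (q \subset B) && (#|q| < k)) h #|q| =
  \sum_(j < k) 'C(#|B|, j) * h j.
Proof.
elim: k => [|k IH]; first by rewrite big_ord0 big_pred0 // => q; rewrite andbF.
rewrite big_ord_recr -IH (bigID (fun q : {set T} => #|q| < k)) /=; congr (_ + _).
  by apply: eq_bigl => q; case: (q \subset B) => //=; lia.
rewrite -cards_draws -sum_nat_const.
apply: eq_big => q; first by rewrite inE; case: (q \subset B) => //=; lia.
by move=> h'; congr h; lia.
Qed.

Lemma proper_subset_card (T : finType) (p q : {set T}) :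
  (q \proper p) = (q \subset p) && (#|q| < #|p|).
Proof.
apply/idP/andP => [qp|[sqp lt_qp]]; first by rewrite proper_sub ?proper_card.
rewrite properE sqp; apply/negP => /subset_leq_card; lia.
Qed.

(** A function of a finite set obeying this recursion depends on the cardinality
of the set only, which makes solutions on different types comparable. *)
Definition subset_rec (T : finType) (u : {set T} -> nat) :=
  forall p, u p = (p == set0) + \sum_(q : {set T} | q \proper p) u q.

(** The common value of all solutions on sets of size [n]. The first argument is
fuel: the recursion calls all smaller sizes, and any [k > n] is enough. *)
Fixpoint size_rec (k n : nat) : nat :=
  if k is k'.+1 then (n == 0) + \sum_(j < n) 'C(n, j) * size_rec k' j else 0.

Lemma subset_rec_size (T : finType) (u : {set T} -> nat) (k : nat) (p : {set T}) :
  subset_rec u -> #|p| < k -> u p = size_rec k #|p|.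
Proof.
move=> hu; elim: k p => // k IH p lt_pk; rewrite hu /= cards_eq0; congr (_ + _).
rewrite -sum_subset_card (eq_bigl _ _ (proper_subset_card p)).
by apply: eq_bigr => q /andP[_ lt_qp]; apply: IH; lia.
Qed.

Lemma subset_rec_unique (T T' : finType) (u : {set T} -> nat)
    (v : {set T'} -> nat) (p : {set T}) (q : {set T'}) :
  subset_rec u -> subset_rec v -> #|p| = #|q| -> u p = v q.
Proof.
move=> hu hv pq.
by rewrite (subset_rec_size hu (ltnSn _)) (subset_rec_size hv (ltnSn _)) pq.
Qed.

Lemma block_subset (T : finType) (P : {set {set T}}) (p B : {set T}) :
  partition P p -> B \in P -> B \subset p.
Proof. by move=> hP BP; rewrite -(cover_partition hP); apply: (bigcup_sup B). Qed.

(** A partition into [k] blocks can be ordered in [k`!] ways. *)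
Definition ordered_partitions (T : finType) (p : {set T}) : nat :=
  \sum_(P : {set {set T}} | partition P p) #|P|`!.

(** The union of all blocks but the last is a proper subset of [p], ordered by the
remaining blocks. On unordered partitions this reads: pairs of a partition
[P] and a block [B] of it correspond to pairs of the proper subset [p :\: B]
and its partition [P :\ B], and [#|P|`! = #|P| * (#|P| - 1)`!] counts the
choices of [B]. *)
Lemma ordered_partitions_rec (T : finType) :
  subset_rec (@ordered_partitions T).
Proof.
move=> p; have [-> | p0] := eqVneq p set0.
  rewrite [X in _ + X]big_pred0 => [|q]; last by rewrite properE sub0set andbF.
  rewrite /ordered_partitions (big_pred1 set0) ?cards0 // => P.
  exact: partition_set0.
rewrite add0n /ordered_partitions.
have -> : \sum_(P | partition P p) #|P|`! =
          \sum_(P | partition P p) \sum_(B in P) #|P :\ B|`!.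
  apply: eq_bigr => P hP; rewrite (eq_bigr (fun=> #|P|.-1`!)) => [|B BP].
    rewrite sum_nat_const; case: (posnP #|P|) => [/cards0_eq P0|/prednK <- //].
    case/and3P: hP => /eqP; rewrite P0 /cover big_set0 => /esym/eqP.
    by rewrite (negPf p0).
  by rewrite (cardsD1 B P) BP.
rewrite !pair_big_dep /=.
rewrite (reindex_onto
  (fun t : {set T} * {set {set T}} => ((p :\: t.1) |: t.2, p :\: t.1))
  (fun t => (p :\: t.2, t.1 :\ t.2))) /=; last first.
  move=> [P B] /andP[/= hP BP]; have Bp := block_subset hP BP.
  by rewrite setDDr setDv set0U (setIidPr Bp) setD1K.
have pq0 (q : {set T}) : q \proper p -> p :\: q != set0.
  by rewrite properE setD_eq0 => /andP[].
have dis (q : {set T}) (Q : {set {set T}}) :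
    q \proper p -> partition Q q -> p :\: q \notin Q.
  move=> qp hQ; apply/negP => pqQ; case/negP: (pq0 _ qp).
  have := block_subset hQ pqQ; rewrite -subset0 => h.
  have: p :\: q \subset q :&: (p :\: q) by rewrite subsetI h subxx.
  by rewrite setIDA setIC -setIDA setDv setI0.
apply: eq_big => [[q Q]|[q Q]] /=; last first.
  move=> /andP[_ /eqP[_ ->]] //.
apply/idP/idP.
  move=> /andP[/andP[hP _] /eqP[Eq EQ]].
  have Bin : p :\: q \in p :\: q |: Q by rewrite setU11.
  have qp : q \proper p.
    rewrite -Eq properEneq subsetDl andbT; apply/eqP => /setDidPl.
    rewrite disjoint_sym => /disjoint_setI0.
    rewrite (setIidPl (subsetDl _ _)) => E.
    by have := partition_neq0 hP Bin; rewrite E eqxx.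
  rewrite qp /=; have := partitionD1 hP Bin.
  by rewrite EQ Eq.
move=> /andP[qp hQ]; have sqp := proper_sub qp.
have eq_q : p :\: (p :\: q) = q by rewrite setDDr setDv set0U; apply/setIidPr.
rewrite setU11 andbT eq_q setU1K ?dis // eqxx andbT.
have pqE : (p :\: q) :|: q = p by rewrite setUC -{1}(setIidPr sqp) setID.
rewrite -[X in partition _ X]pqE.
apply: partitionU1 => //; first exact: pq0.
by rewrite disjoint_sym disjoints_subset; apply/subsetP => x xq; rewrite !inE xq.
Qed.

Lemma card_partition_leq (T : finType) (P : {set {set T}}) (p : {set T}) :
  partition P p -> #|P| <= #|p|.
Proof.
move=> hP; rewrite (card_partition hP) -sum1_card; apply: leq_sum => A AP.
by rewrite card_gt0 (partition_neq0 hP).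
Qed.

Lemma fubini_ordered_partitions (T : finType) (p : {set T}) :
  ordered_partitions p = fubini #|p|.
Proof.
have -> : fubini #|p| = ordered_partitions [set: 'I_#|p|].
  rewrite /fubini big_mkord /ordered_partitions.
  rewrite (partition_big
    (fun P : {set {set 'I_#|p|}} => inord #|P| : 'I_#|p|.+1) predT) //=.
  apply: eq_bigr => k _; rewrite mulnC /stirling2 -sum_nat_const.
  have h (P : {set {set 'I_#|p|}}) : partition P [set: 'I_#|p|] ->
      ((inord #|P| : 'I_#|p|.+1) == k) = (#|P| == k).
    move=> /card_partition_leq; rewrite cardsT card_ord => le.
    by rewrite -val_eqE /= inordK.
  apply: eq_big => [P|P].
    by rewrite inE; case hP: (partition P _) => //=; rewrite h.
  by rewrite inE => /andP[_ /eqP->].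
apply: subset_rec_unique; try exact: ordered_partitions_rec.
by rewrite cardsT card_ord.
Qed.

Definition topped_chains (T : finType) (p : {set T}) : {set {set {set T}}} :=
  [set C in order_complex (powerset p) | p \in C].

Lemma order_complexP (T : finType) (L C : {set {set T}}) :
  reflect (C \subset L /\
           forall F G, F \in C -> G \in C -> (F \subset G) || (G \subset F))
          (C \in order_complex L).
Proof.
rewrite inE; apply: (iffP andP) => -[CL cC]; split=> //.
  by move=> F G hF hG; have /forall_inP/(_ _ hF)/forall_inP/(_ _ hG) := cC.
by apply/forall_inP => F hF; apply/forall_inP => G hG; apply: cC.
Qed.

(** The union of a finite nonempty chain is its top element, so that [cover]
serves as a total top function on chains. *)
Lemma cover_chain (T : finType) (L C : {set {set T}}) :
  C \in order_complex L -> C != set0 -> cover C \in C.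
Proof.
move=> /order_complexP[_ cC] /set0Pn[F0 hF0].
case: (arg_maxnP (fun F : {set T} => #|F|) hF0) => F hF maxF.
suff -> : cover C = F by [].
apply/eqP; rewrite eqEsubset; apply/andP; split; last exact: (bigcup_sup F).
apply/bigcupsP => G hG; case/orP: (cC _ _ hF hG) => // FG.
by have /eqP -> : F == G by rewrite eqEcard FG; apply: maxF.
Qed.

Lemma topped_chainsE (T : finType) (L C : {set {set T}}) (p : {set T}) :
  powerset p \subset L ->
  (C \in topped_chains p) =
  [&& C \in order_complex L, C != set0 & cover C == p].
Proof.
move=> pL; rewrite inE; apply/andP/and3P.
  move=> [/order_complexP[Cp cC] pC]; split.
  - by apply/order_complexP; split=> //; apply: subset_trans pL.
  - by apply/set0Pn; exists p.
  rewrite eqEsubset (bigcup_sup p) // andbT; apply/bigcupsP => F FC.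
  by have := subsetP Cp _ FC; rewrite inE.
move=> [hC C0 /eqP Cp]; rewrite -{2}Cp (cover_chain hC C0); split=> //.
case/order_complexP: hC => _ cC; apply/order_complexP; split=> //.
by apply/subsetP => F FC; rewrite inE -Cp; apply: (bigcup_sup F).
Qed.

Lemma topped_chains_below (T : finType) (p q : {set T}) C :
  C \in topped_chains p -> q \in C -> q \subset p.
Proof.
by rewrite inE => /andP[/order_complexP[Cp _] _] /(subsetP Cp); rewrite inE.
Qed.

Lemma topped_chains_top (T : finType) (p : {set T}) C :
  C \in topped_chains p -> p \in C.
Proof. by rewrite inE => /andP[]. Qed.

(** Without its top [p], a chain is either empty or has a top that is a proper
subset of [p]. *)
Lemma card_topped_chains_rec (T : finType) (p : {set T}) :
  #|topped_chains p| = (\sum_(q : {set T} | q \proper p) #|topped_chains q|).+1.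
Proof.
have topp : [set p] \in topped_chains p.
  rewrite inE set11 andbT; apply/order_complexP; split.
    by rewrite sub1set inE.
  by move=> F G /set1P-> /set1P->; rewrite subxx.
rewrite -sum1_card (bigD1 _ topp) /= add1n; congr _.+1.
have main C : C \in topped_chains p -> C != [set p] -> [/\
    C :\ p \in order_complex [set: {set T}], C :\ p != set0 &
    cover (C :\ p) \proper p].
  move=> hC Cp; move: (hC); rewrite inE => /andP[/order_complexP[_ cC] pC].
  have hD : C :\ p \in order_complex [set: {set T}].
    apply/order_complexP; split; first exact: subsetT.
    by move=> F G /setD1P[_ FC] /setD1P[_ GC]; apply: cC.
  have D0 : C :\ p != set0.
    by apply: contra Cp => /eqP D0; rewrite -(setD1K pC) D0 setU0.
  split=> //; have /setD1P[neq cin] := cover_chain hD D0.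
  by rewrite properEneq neq (topped_chains_below hC).
rewrite (partition_big (fun C => cover (C :\ p))
                       (fun q : {set T} => q \proper p)) /=; last first.
  by move=> C /andP[hC Cp]; case: (main _ hC Cp).
apply: eq_bigr => q qp; rewrite -sum1_card.
rewrite (reindex_onto (fun C => p |: C) (fun C => C :\ p)) /=; last first.
  by move=> C /andP[/andP[hC _] _]; rewrite setD1K // topped_chains_top.
apply: eq_bigl => C; rewrite (topped_chainsE _ (subsetT (powerset q))).
have [hqp pq] : q \subset p /\ ~~ (p \subset q) by move: qp; rewrite properE => /andP.
apply/idP/idP.
  move=> /andP[/andP[/andP[hC Cp] Cq] /eqP CD].
  by have [] := main _ hC Cp; rewrite CD in Cq *; move=> -> ->.
move=> /and3P[hC C0 /eqP Cq].
have below F : F \in C -> F \subset q by move=> FC; rewrite -Cq; apply: (bigcup_sup F).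
have pC : p \notin C by apply/negP => /below; apply/negP.
rewrite setU1K // eqxx andbT Cq eqxx andbT; apply/andP; split; last first.
  apply: contra C0 => /eqP E; rewrite -subset0; apply/subsetP => F FC.
  have : F \in p |: C by rewrite inE FC orbT.
  by rewrite E => /set1P Fp; rewrite -Fp FC in pC.
case/order_complexP: hC => _ cC.
have belowp F : F \in C -> F \subset p by move=> /below/subset_trans; apply.
change (p |: C \in topped_chains p); rewrite inE setU11 andbT.
apply/order_complexP; split.
  by apply/subsetP => F /setU1P[-> | /belowp]; rewrite inE ?subxx.
move=> F G /setU1P[-> | FC] /setU1P[-> | GC]; rewrite ?subxx ?belowp ?orbT //.
exact: cC.
Qed.

(** For nonempty [p], the empty set can be added to a chain or removed from it,
whence the factor [2]; it is forced in the unique chain with top [set0], which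
the extra summand corrects. The proof only compares the two recursions. *)
Lemma card_topped_chains (T : finType) (p : {set T}) :
  #|topped_chains p| + (p == set0) = 2 * fubini #|p|.
Proof.
rewrite -fubini_ordered_partitions.
move: {2}_.+1 (ltnSn #|p|) => k; elim: k p => // k IH p lt_pk.
rewrite card_topped_chains_rec ordered_partitions_rec.
have [-> | [x xp]] := set_0Vmem p.
  by rewrite !big_pred0 ?eqxx // => q; rewrite properE sub0set andbF.
have p0 : p != set0 by apply/set0Pn; exists x.
rewrite (negPf p0) addn0 add0n big_distrr /=.
rewrite [RHS](eq_bigr (fun q : {set T} => #|topped_chains q| + (q == set0))) => [|q qp].
  rewrite big_split /= -addn1; congr (_ + _).
  rewrite (bigD1 set0) ?eqxx /=; last by rewrite properE sub0set subset0.
  by rewrite big1 // => q /andP[_ /negPf ->].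
by rewrite IH //; have := proper_card qp; lia.
Qed.

(** * Flats and cells of uniform matroids *)

Lemma rk_subset (E : finType) (M : matroid E) (F G : {set E}) :
  F \subset G -> rk M F <= rk M G.
Proof.
move=> FG; rewrite /rk -!subn1 leq_sub2r //; apply/bigmax_leqP => C hC.
apply: leq_bigmax_cond; case/order_complexP: hC => CF cC.
apply/order_complexP; split=> //; apply: subset_trans CF _.
by apply/subsetP => H; rewrite !inE => /andP[-> /subset_trans]; apply.
Qed.

Lemma corank_subset (E : finType) (M : matroid E) (F G : {set E}) :
  F \subset G -> corank M G <= corank M F.
Proof. by move=> /(rk_subset M) h; rewrite /corank leq_sub2l. Qed.

Lemma in_flats_uniform (r n : nat) (F : {set 'I_n}) :
  (F \in flats (uniform_matroid r n)) = (F == [set: 'I_n]) || (#|F| < r).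
Proof. by rewrite inE. Qed.

(** In a uniform matroid [minn #|F| r] is the height of the flat [F]: a chain of
this length is built by descending through subsets of [F]. *)
Lemma uniform_chain (r n k : nat) (F : {set 'I_n}) :
  F \in flats (uniform_matroid r n) -> minn #|F| r = k ->
  exists2 C, C \in order_complex (flats_below (uniform_matroid r n) F) &
             #|C| = k.+1.
Proof.
elim: k F => [|k IH] F hF Fk.
  exists [set F]; last by rewrite cards1.
  apply/order_complexP; split; first by rewrite sub1set inE hF subxx.
  by move=> G H /set1P-> /set1P->; rewrite subxx.
have [G /andP[GF /eqP Gk]] : exists G : {set 'I_n}, (G \subset F) && (#|G| == k).
  have : 0 < #|[set G : {set 'I_n} | G \subset F & #|G| == k]|.
    by rewrite cards_draws bin_gt0; lia.
  by rewrite card_gt0 => /set0Pn[G]; rewrite inE; exists G.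
have hG : G \in flats (uniform_matroid r n) by rewrite in_flats_uniform; lia.
have [|C hC Ck] := IH G hG; first by lia.
case/order_complexP: hC => CG cC.
have below H : H \in C -> H \subset G.
  by move=> /(subsetP CG); rewrite inE => /andP[].
have belowF H : H \in C -> H \subset F by move=> /below/subset_trans; apply.
exists (F |: C).
  apply/order_complexP; split.
    apply/subsetP => H /setU1P[-> | HC]; first by rewrite inE hF subxx.
    by rewrite inE belowF // andbT; have := subsetP CG _ HC; rewrite inE => /andP[].
  move=> H K /setU1P[-> | HC] /setU1P[-> | KC]; rewrite ?subxx ?belowF ?orbT //.
  exact: cC.
rewrite cardsU1 Ck; case: (boolP (F \in C)) => // /below/subset_leq_card; lia.
Qed.

(** No chain is longer, because [minn #|F| r] is injective on chains of flats:
the only flat of size at least [r] is the whole set. *)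
Lemma rk_uniform (r n : nat) (F : {set 'I_n}) : r <= n ->
  F \in flats (uniform_matroid r n) ->
  rk (uniform_matroid r n) F = minn #|F| r.
Proof.
move=> rn hF; set k := minn _ _.
suff: \max_(C in order_complex (flats_below (uniform_matroid r n) F)) #|C| =
      k.+1.
  by rewrite /rk => ->.
apply/eqP; rewrite eqn_leq; apply/andP; split; last first.
  have [C hC <-] := uniform_chain hF (erefl k).
  exact: (leq_bigmax_cond (F := fun C : {set {set 'I_n}} => #|C|)).
apply/bigmax_leqP => C /order_complexP[CF cC].
pose f (G : {set 'I_n}) : 'I_k.+1 := inord (minn #|G| r).
have fE G : G \in C -> f G = minn #|G| r :> nat.
  move=> /(subsetP CF); rewrite inE => /andP[_ /subset_leq_card GF].
  by rewrite inordK // /k; lia.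
have inj : {in C &, injective f}.
  move=> G H GC HC /(congr1 val); rewrite /= !fE // => GH.
  have := subsetP CF _ GC; have := subsetP CF _ HC.
  rewrite !inE => /andP[hH _] /andP[hG _].
  have szT : #|[set: 'I_n]| = n by rewrite cardsT card_ord.
  have eqGH : #|G| = #|H|.
    move: hG hH => /orP[/eqP G_|hG] /orP[/eqP H_|hH]; move: GH;
      by rewrite ?G_ ?H_ ?szT //; lia.
  apply/eqP; case/orP: (cC _ _ GC HC) => sub; first by rewrite eqEcard sub eqGH leqnn.
  by rewrite eq_sym eqEcard sub eqGH leqnn.
by rewrite -(card_in_imset inj) (leq_trans (max_card _)) // card_ord.
Qed.

Lemma rank_uniform (r n : nat) : r <= n -> rank (uniform_matroid r n) = r.
Proof.
move=> rn; rewrite /rank rk_uniform //; last by rewrite in_flats_uniform eqxx.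
by rewrite cardsT card_ord; lia.
Qed.

Lemma corank_uniform (r n : nat) (F : {set 'I_n}) : r <= n -> #|F| < r ->
  corank (uniform_matroid r n) F = r - #|F|.
Proof.
move=> rn Fr; rewrite /corank rank_uniform // rk_uniform //.
  by rewrite (minn_idPl (ltnW Fr)).
by rewrite in_flats_uniform Fr orbT.
Qed.

(** A face of the join chooses, for every index below [c], one of the two points
or none of them. *)
Lemma card_join_S0 (m c : nat) : c <= m -> #|join_S0 m c| = 3 ^ c.
Proof.
move=> cm.
pose g (f : {ffun 'I_m -> option bool}) : {set 'I_m * bool} :=
  [set v | f v.1 == Some v.2].
have gE f i b : ((i, b) \in g f) = (f i == Some b) by rewrite inE.
have g_inj : injective g.
  move=> f f' ff'; apply/ffunP => i.
  have h b : (f i == Some b) = (f' i == Some b) by rewrite -!gE ff'.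
  by case: (f i) (f' i) h => [b|] [b'|] // h;
    [have := h b | have := h b | have := h b']; rewrite eqxx // => /esym/eqP.
pose D := [pred i : 'I_m | i < c].
have -> : join_S0 m c = g @: [set f in pffun_on None D predT].
  apply/setP => s; rewrite inE; apply/andP/imsetP.
    move=> [/forallP h1 /forall_inP h2].
    exists [ffun i => [pick b | (i, b) \in s]]; last first.
      apply/setP => -[i b]; rewrite gE ffunE.
      have := h1 i; rewrite inE => /card_le1_eqP/= h.
      case: pickP => [b' ib'|]; last by move=> ->.
      apply/idP/eqP => [ib|[<-]//]; congr Some; apply: h; by rewrite inE.
    rewrite inE; apply/pffun_onP; split=> //.
    apply/supportP => i iD; rewrite ffunE; case: pickP => // b /h2 /= ic.
    by rewrite inE /= ic in iD.
  move=> [f]; rewrite inE => /pffun_onP[/supportP hf _] ->; split.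
    apply/forallP => i; rewrite inE; apply/card_le1_eqP => b b'.
    by rewrite !inE /= => /eqP-> /eqP[].
  apply/forall_inP => -[i b]; rewrite gE /= => /eqP fi.
  by apply/negPn/negP => ic; move: fi; rewrite hf.
rewrite card_imset // cardsE card_pffun_on card_option card_bool; congr (_ ^ _).
transitivity (\sum_(i < m | i < c) 1); first by rewrite -sum1_card; apply: eq_bigl.
by rewrite -(big_ord_widen m (fun=> 1) cm) sum1_card card_ord.
Qed.

(** The candidates for the cells, each listed once: a cell [s * e] of the summand
of any [p] also lies in the summand of the top of [s]. *)
Definition cell_pairs (E : finType) (M : matroid E) :
    {set {set {set E}} * {set 'I_(rank M) * bool}} :=
  [set t | [&& t.1 \in order_complex (flats M), t.1 != set0,
               t.2 \in Dfaces M (cover t.1) & t.2 != set0]].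

(** The chains with top the whole set contribute no cell, since its corank is
[0]; below the other flats every subset is a flat, which leaves
[topped_chains]. *)
Lemma card_cell_pairs_uniform (r n : nat) : r <= n ->
  #|cell_pairs (uniform_matroid r n)| =
  \sum_(k < r) 'C(n, k) * ((2 * fubini k - (k == 0 :> nat)) * (3 ^ (r - k)).-1).
Proof.
move=> rn; set M := uniform_matroid r n.
have cardD p : #|Dfaces M p :\ set0| = (3 ^ corank M p).-1.
  have <- : #|Dfaces M p| = 3 ^ corank M p by rewrite card_join_S0 // leq_subr.
  rewrite (cardsD1 set0 (Dfaces M p)) (_ : set0 \in _) //.
  rewrite inE; apply/andP; split.
    apply/forallP => i; rewrite inE (_ : [set b | _] = set0) ?cards0 //.
    by apply/setP => b; rewrite !inE.
  by apply/forall_inP => v; rewrite inE.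
have -> : #|cell_pairs M| =
    \sum_(C in order_complex (flats M) | C != set0) (3 ^ corank M (cover C)).-1.
  under eq_bigr do rewrite -cardD -sum1_card.
  rewrite pair_big_dep -sum1_card /=; apply: eq_bigl => -[C e].
  by rewrite !inE /= andbA; congr andb; rewrite andbC.
rewrite (partition_big (@cover _) [in flats M]) /=; last first.
  move=> C /andP[hC C0]; have [/subsetP sub _] := order_complexP _ _ hC.
  by apply: sub; apply: cover_chain hC C0.
rewrite (bigID (fun p : {set 'I_n} => #|p| < r)) /= [X in _ + X]big1 ?addn0; last first.
  move=> p /andP[hp pr]; rewrite big1 // => C /andP[_ /eqP ->].
  move: hp; rewrite in_flats_uniform (negPf pr) orbF => /eqP ->.
  by rewrite /corank subnn.
have cardT : #|[set: 'I_n]| = n by rewrite cardsT card_ord.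
pose h k := (2 * fubini k - (k == 0)) * (3 ^ (r - k)).-1.
have := sum_subset_card [set: 'I_n] r h; rewrite cardT => <-.
apply: eq_big => p; first by rewrite in_flats_uniform subsetT /=; lia.
move=> /andP[_ pr].
have sub : powerset p \subset flats M.
  apply/subsetP => q; rewrite inE => /subset_leq_card qp.
  by rewrite in_flats_uniform (leq_ltn_trans qp pr) orbT.
rewrite (eq_bigr (fun=> (3 ^ (r - #|p|)).-1)); last first.
  by move=> C /andP[_ /eqP ->]; rewrite corank_uniform.
rewrite (eq_bigl [in topped_chains p]) => [|C].
  by rewrite sum_nat_const /h -card_topped_chains cards_eq0 addnK.
by rewrite /= (topped_chainsE _ sub) andbA.
Qed.

(** * Covectors of uniform oriented matroids *)

(** The number of covectors of a uniform oriented matroid of rank [k] on [m >= k]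
elements. *)
Definition uniform_count (k m : nat) : nat :=
  (\sum_(j < k) 'C(m, j) * (odd (k - j) * 2 ^ j.+1)).+1.

Lemma uniform_count0 m : uniform_count 0 m = 1.
Proof. by rewrite /uniform_count big_ord0. Qed.

Lemma uniform_countS k m :
  uniform_count k.+1 m.+1 + 2 = uniform_count k.+1 m + 2 * uniform_count k m.
Proof.
rewrite /uniform_count !big_ord_recl /= !bin0 mulnS big_distrr /=.
set c := 1 * _; set S1 := \sum_(i < k) _; set S2 := \sum_(i < k) _.
set S3 := \sum_(i < k) _.
suff -> : S1 = S2 + S3 by lia.
rewrite /S1 /S2 /S3 -big_split /=; apply: eq_bigr => i _.
rewrite /bump /= add1n binS mulnDl subSS (expnS 2 i.+1); congr (_ + _).
by rewrite [RHS]mulnCA (mulnCA 2 (odd _)).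
Qed.

(** The sum is the binomial expansion of [(1 + 2) ^ k - (-1 + 2) ^ k], in which
the terms with [k - j] even cancel and the others double. *)
Lemma uniform_count_free k : uniform_count k k = 3 ^ k.
Proof.
suff : ((\sum_(j < k) 'C(k, j) * (odd (k - j) * 2 ^ j.+1))%:Z = 3 ^+ k - 1 :> int)%R.
  rewrite /uniform_count => h; apply/eqP; rewrite -eqz_nat -addn1 PoszD h.
  by rewrite subrK -[Posz (3 ^ k)]natz natrX.
have -> : (3 ^+ k - 1 = (1 + 2) ^+ k - (-1 + 2) ^+ k :> int)%R.
  by rewrite (_ : -1 + 2 = 1)%R // expr1n.
rewrite !exprDn -sumrB big_ord_recr /= subnn !expr0 subrr addr0 -natz natr_sum.
apply: eq_bigr => j _; rewrite expr1n -mulrnBl -mulrBl.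
rewrite -signr_odd !natrM natrX exprS; rewrite -[RHS]mulr_natl.
congr (_ * _)%R; case: (odd _); last by rewrite expr0 subrr !mul0r.
by rewrite expr1 opprK mul1r.
Qed.

Section CountingCovectors.
Variables (E : finType) (M : oriented_matroid E) (r : nat).
Hypothesis small_flat : forall F : {set E}, #|F| < r ->
  exists2 X, X \in covectors M & zero_set X = F.
Hypothesis large_flat : forall X, X \in covectors M -> r <= #|zero_set X| ->
  X = zero_vec E.
Implicit Types (A B : {set E}) (X Y : {ffun E -> sign}).

Definition restrict B X : {ffun E -> sign} :=
  [ffun e => if e \in B then X e else Zero].

(** Minors are represented without changing the ground set: [minor_covectors A B]
are the covectors obtained by contracting [A] and deleting everything outside
the union of [A] and [B], padded with zeros. *)
Definition minor_covectors A B : {set {ffun E -> sign}} :=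
  [set restrict B X | X in covectors M & A \subset zero_set X].

(** The sign at [e] is prescribed but, for [e] outside [B], forgotten by the
restriction: the vectors that extend by different signs can be compared. *)
Definition minor_extensions A B e s : {set {ffun E -> sign}} :=
  [set restrict B X | X in covectors M & (A \subset zero_set X) && (X e == s)].

Lemma zero_setP A X : reflect {in A, forall e, X e = Zero} (A \subset zero_set X).
Proof.
apply: (iffP subsetP) => h e /h; first by rewrite inE => /eqP.
by rewrite inE => ->.
Qed.

Lemma minor_covectorsP A B Y :
  reflect (exists X, [/\ X \in covectors M, {in A, forall e, X e = Zero} &
                         Y = restrict B X])
          (Y \in minor_covectors A B).
Proof.
apply: (iffP imsetP) => [[X]|[X [hX XA ->]]].
  by rewrite inE => /andP[hX /zero_setP XA] ->; exists X.
by exists X => //; rewrite inE hX; apply/zero_setP.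
Qed.

Lemma minor_extensionsP A B e s Y :
  reflect (exists X, [/\ X \in covectors M, {in A, forall f, X f = Zero},
                         X e = s & Y = restrict B X])
          (Y \in minor_extensions A B e s).
Proof.
apply: (iffP imsetP) => [[X]|[X [hX XA Xe ->]]].
  by rewrite inE => /and3P[hX /zero_setP XA /eqP Xe] ->; exists X.
by exists X => //; rewrite inE hX Xe eqxx andbT; apply/zero_setP.
Qed.

Lemma covector_signed X e s : X \in covectors M -> X e != Zero -> s != Zero ->
  exists Y, [/\ Y \in covectors M, Y e = s & zero_set Y = zero_set X].
Proof.
move=> hX Xe s0; have [Xs | Xs] := eqVneq (X e) s; first by exists X.
exists (opp_vec X); split; first exact: covectorN.
  by rewrite ffunE; move: Xs Xe s0; case: (X e); case: s.
by apply/setP => f; rewrite !inE ffunE; case: (X f).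
Qed.

(** On an independent set every sign vector occurs. It is built one coordinate at
a time by composing with a covector whose support within [A :|: B] is a single
element; such a covector exists because the other elements form a flat. *)
Lemma minor_covectors_free A B : [disjoint A & B] -> #|A| + #|B| <= r ->
  #|minor_covectors A B| = 3 ^ #|B|.
Proof.
move=> dAB cAB.
have card_sign : #|{: sign}| = 3.
  rewrite -(card_image (can_inj sign_to_optionK)) -[3]/(2.+1) -card_bool -card_option.
  by apply: eq_card => o; rewrite !inE; apply/mapP; exists (option_to_sign o);
    rewrite ?mem_enum //; case: o => [[]|].
have -> : minor_covectors A B = [set Y in pffun_on Zero B predT].
  apply/setP => Y; rewrite inE; apply/minor_covectorsP/pffun_onP.
    move=> [X [_ _ ->]]; split=> //; apply/supportP => e eB.
    by rewrite ffunE (negPf eB).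
  move=> [/supportP YB _].
  (* The coordinates are filled in by increasing rank in the enumeration of [E]. *)
  suff ex k : exists X, [/\ X \in covectors M, {in A, forall f, X f = Zero} &
      {in B, forall f, X f = if enum_rank f < k then Y f else Zero}].
    have [X [hX XA XB]] := ex #|E|; exists X; split=> //.
    apply/ffunP => f; rewrite ffunE; case: ifP => [fB | /negbT/YB //].
    by rewrite XB // ltn_ord.
  elim: k => [|k [X [hX XA XB]]].
    by exists (zero_vec E); split=> [|f _|f _]; rewrite ?covector0 ?ffunE.
  have same : (forall e : E, e \in B -> Y e != Zero -> enum_rank e = k :> nat -> False) ->
      {in B, forall f, X f = if enum_rank f < k.+1 then Y f else Zero}.
    move=> h f fB; rewrite XB // ltnS (leq_eqVlt (enum_rank f)).
    have [fk|] := eqVneq (enum_rank f : nat) k => //=.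
    rewrite fk ltnn; have [-> //|Yf] := eqVneq (Y f) Zero.
    by case: (h f fB Yf fk).
  case: (pickP [pred e in B | (Y e != Zero) && (enum_rank e == k :> nat)]); last first.
    move=> h; exists X; split=> //; apply: same => e eB Ye ek.
    by have := h e; rewrite /= eB Ye ek eqxx.
  move=> e /= /and3P[eB Ye /eqP ek].
  have eA : e \notin A by rewrite (disjointFl dAB).
  have [W hW WAB] : exists2 W, W \in covectors M & zero_set W = A :|: B :\ e.
    apply: small_flat; apply: leq_trans cAB.
    rewrite (cardsD1 e B) eB addnCA add1n ltnS; exact: leq_card_setU.
  have We : W e != Zero.
    have : e \notin zero_set W by rewrite WAB !inE eqxx (negPf eA).
    by rewrite inE.
  have [V [hV Ve]] := covector_signed hW We Ye; rewrite WAB => VAB.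
  have V0 f : f \in A :|: B :\ e -> V f = Zero by rewrite -VAB inE => /eqP.
  exists (compose X V); split; first exact: covectorC.
    by move=> f fA; rewrite ffunE XA // eqxx V0 // inE fA.
  move=> f fB; rewrite ffunE XB //; have [-> | fe] := eqVneq f e.
    by rewrite ek ltnn ltnSn eqxx Ve.
  have Vf : V f = Zero by rewrite V0 // !inE fe fB orbT.
  have fk : (enum_rank f == k :> nat) = false.
    by apply/negbTE; rewrite -ek; apply: contra fe => /eqP/val_inj/enum_rank_inj->.
  rewrite Vf ltnS (leq_eqVlt (enum_rank f)) fk /=; case: (enum_rank f < k) => //.
  by case: eqP => // ->.
by rewrite cardsE card_pffun_on card_sign.
Qed.

Lemma minor_covectors_large A B : r <= #|A| -> #|minor_covectors A B| = 1.
Proof.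
move=> rA; apply/eqP/cards1P; exists (restrict B (zero_vec E)).
apply/setP => Y; rewrite inE; apply/minor_covectorsP/eqP.
  move=> [X [hX /zero_setP XA ->]]; congr restrict; apply: large_flat => //.
  exact: leq_trans (subset_leq_card XA).
by move=> ->; exists (zero_vec E); split=> [|f _|//]; rewrite ?covector0 ?ffunE.
Qed.

Lemma minor_covectors_split A B e : e \in B ->
  #|minor_covectors A B| = #|minor_extensions A (B :\ e) e Zero| +
    (#|minor_extensions A (B :\ e) e Pos| + #|minor_extensions A (B :\ e) e Neg|).
Proof.
move=> eB; set S := minor_covectors A B.
have piece s : #|[set Y in S | Y e == s]| = #|minor_extensions A (B :\ e) e s|.
  rewrite -(card_in_imset (f := restrict (B :\ e))).
    apply: eq_card => Y; apply/imsetP/minor_extensionsP.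
      move=> [_ /setIdP[/minor_covectorsP[X [hX XA ->]] /eqP Xe] ->].
      exists X; split=> //; first by move: Xe; rewrite ffunE eB.
      by apply/ffunP => f; rewrite !ffunE in_setD1; case: (f == e); case: (f \in B).
    move=> [X [hX XA Xe ->]]; exists (restrict B X).
      rewrite inE ffunE eB Xe eqxx andbT; apply/minor_covectorsP.
      by exists X.
    by apply/ffunP => f; rewrite !ffunE in_setD1; case: (f == e); case: (f \in B).
  move=> Y Y' /setIdP[/minor_covectorsP[X [_ _ ->]] /eqP Xe].
  move=> /setIdP[/minor_covectorsP[X' [_ _ ->]] /eqP Xe'] /ffunP h.
  apply/ffunP => f; have [-> | fe] := eqVneq f e; first by rewrite Xe Xe'.
  by have := h f; rewrite !ffunE !inE fe; case: (f \in B).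
rewrite -!piece -(cardsID [set Y : {ffun E -> sign} | Y e == Zero] S); congr (_ + _).
  by apply: eq_card => Y; rewrite !inE.
rewrite -(cardsID [set Y : {ffun E -> sign} | Y e == Pos]); congr (_ + _).
    by apply: eq_card => Y; rewrite !inE; case: (Y e); rewrite ?andbF.
by apply: eq_card => Y; rewrite !inE; case: (Y e); rewrite ?andbF ?andbT.
Qed.

(** Among the vectors on [B :\ e], let [P s] be those that extend by the sign [s]
at [e]. All the vectors of the deletion lie in the union of the [P s], and
[P Zero] is the contraction. Elimination shows that [P Pos :&: P Neg] is
contained in [P Zero]; conversely a nonzero vector in [P Zero] has a zero set
which stays a flat when [e] is removed, so it extends by all three signs, while
the zero vector extends by [Zero] only. *)
Lemma minor_covectors_delete A B e : e \in B -> [disjoint A & B] ->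
  r <= #|A| + #|B :\ e| ->
  #|minor_covectors A B| + 2 =
  #|minor_covectors A (B :\ e)| + 2 * #|minor_covectors (e |: A) (B :\ e)|.
Proof.
move=> eB dAB rAB; rewrite (minor_covectors_split A eB).
have eA : e \notin A by rewrite (disjointFl dAB).
set P := minor_extensions A (B :\ e) e; set z := zero_vec E.
have rz : z = restrict (B :\ e) z by apply/ffunP => f; rewrite !ffunE if_same.
have P0 : minor_covectors (e |: A) (B :\ e) = P Zero.
  apply/setP => Y; apply/minor_covectorsP/minor_extensionsP.
    move=> [X [hX XA ->]]; exists X; split=> //; last by rewrite XA ?setU11.
    by move=> f fA; rewrite XA // inE fA orbT.
  move=> [X [hX XA Xe ->]]; exists X; split=> // f /setU1P[->|] //; exact: XA.
have zP0 : z \in P Zero.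
  apply/minor_extensionsP; exists z; split; rewrite ?covector0 // /z ?ffunE //.
  by move=> f _; rewrite ffunE.
have zP s : s != Zero -> z \notin P s.
  move=> s0; apply/minor_extensionsP => -[X [hX XA Xe Xz]].
  case/eqP: s0; rewrite -Xe (_ : X = z) ?ffunE //.
  apply: large_flat => //; apply: leq_trans rAB _.
  rewrite -cardsUI (_ : A :&: _ = set0) ?cards0 ?addn0; last first.
    apply/eqP; rewrite -subset0; apply/subsetP => f /setIP[fA /setD1P[_]].
    by rewrite (disjointFr dAB fA).
  apply/subset_leq_card/zero_setP => f /setUP[/XA // | fB].
  by have /ffunP/(_ f) := Xz; rewrite !ffunE fB => <-.
have extend s Y : s != Zero -> Y \in P Zero -> Y != z -> Y \in P s.
  move=> s0 /minor_extensionsP[X [hX XA Xe ->]] Yz.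
  have [W hW WX] : exists2 W, W \in covectors M & zero_set W = zero_set X :\ e.
    apply: small_flat; apply: leq_ltn_trans (subset_leq_card (subD1set _ _)) _.
    rewrite ltnNge; apply: contra Yz => /(large_flat hX) ->.
    by rewrite -rz.
  have We : W e != Zero.
    have : e \notin zero_set W by rewrite WX !inE eqxx.
    by rewrite inE.
  have [V [hV Ve]] := covector_signed hW We s0; rewrite WX => VX.
  have V0 f : f != e -> X f = Zero -> V f = Zero.
    by move=> fe Xf; apply/eqP; move/setP/(_ f): VX; rewrite !inE fe Xf eqxx.
  apply/minor_extensionsP; exists (compose X V); split.
  - exact: covectorC.
  - move=> f fA; rewrite ffunE XA // eqxx V0 ?XA //.
    by apply: contraNneq eA => <-.
  - by rewrite ffunE Xe eqxx.
  apply/ffunP => f; rewrite !ffunE !inE; have [//|fe] := eqVneq f e.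
  by have [Xf|//] := eqVneq (X f) Zero; rewrite Xf V0.
have elim Y : Y \in P Pos -> Y \in P Neg -> Y \in P Zero.
  move=> /minor_extensionsP[X [hX XA Xe ->]] /minor_extensionsP[X' [hX' XA' Xe' XX']].
  have /(covector_elim hX hX')[Z [hZ Ze ZXX']] : e \in separation X X'.
    by rewrite inE Xe Xe'.
  have eqZ f : X f = X' f -> Z f = X f.
    move=> Xf; have [|-> _] := ZXX' f; last first.
      by rewrite ffunE -Xf; case: eqP.
    by rewrite inE -Xf; case: (X f).
  apply/minor_extensionsP; exists Z; split=> //.
    by move=> f fA; rewrite eqZ XA // XA'.
  apply/ffunP => f; have /ffunP/(_ f) := XX'; rewrite !ffunE.
  by case: ifP => // _ /eqZ.
have all : minor_covectors A (B :\ e) = z |: (P Pos :|: P Neg).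
  apply/setP => Y; rewrite in_setU1 in_setU; apply/minor_covectorsP/idP.
    move=> [X [hX XA ->]]; have [//|Yz /=] := eqVneq (restrict (B :\ e) X) z.
    have : restrict (B :\ e) X \in P (X e) by apply/minor_extensionsP; exists X.
    case: (X e) => h; rewrite ?h ?orbT //; by rewrite extend.
  case/or3P => [/eqP -> | /minor_extensionsP[X [hX XA _ ->]] |
                          /minor_extensionsP[X [hX XA _ ->]]]; try by exists X.
  by exists z; split=> //; rewrite ?covector0 // => f _; rewrite ffunE.
rewrite P0 all cardsU1 in_setU !(negPf (zP _ _)) //= add1n.
have arith a b c d i : a = 1 + i -> d + i = b + c ->
    a + (b + c) + 2 = d.+1 + 2 * a by lia.
apply: (arith _ _ _ _ #|P Zero :\ z|).
  by rewrite (cardsD1 z (P Zero)) zP0.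
have <- : P Pos :&: P Neg = P Zero :\ z; last exact: cardsUI.
apply/setP => Y; rewrite in_setI in_setD1; apply/andP/andP.
  by move=> [Yp Yn]; split; [apply: contraTneq Yp => ->; exact: zP | exact: elim].
by move=> [Yz Y0]; split; apply: extend.
Qed.

(** Induction on [#|B|]. If [#|A| = r], only the zero vector is left; if
[A :|: B] has exactly [r] elements, it is independent; otherwise an element of
[B] can be deleted. *)
Lemma card_minor_covectors A B : [disjoint A & B] -> #|A| <= r <= #|A| + #|B| ->
  #|minor_covectors A B| = uniform_count (r - #|A|) #|B|.
Proof.
move: {2}#|B| (erefl #|B|) => m.
elim: m A B => [|m IH] A B Bm dAB /andP[Ar rAB]; have [rA | Ar'] := leqP r #|A|.
1,3: rewrite minor_covectors_large // (eqP (_ : r - #|A| == 0)) ?subn_eq0 //.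
1,2: by rewrite uniform_count0.
  by rewrite Bm addn0 leqNgt Ar' in rAB.
have [rAB' | ltr] := leqP (#|A| + #|B|) r.
  have <- : #|B| = r - #|A|.
    by apply/eqP; rewrite -(eqn_add2l #|A|) subnKC // eqn_leq rAB rAB'.
  by rewrite minor_covectors_free // uniform_count_free.
have /card_gt0P[e eB] : 0 < #|B| by rewrite Bm.
have eA : e \notin A by rewrite (disjointFl dAB).
have cB : #|B :\ e| = m by have := cardsD1 e B; rewrite eB; lia.
have cA : #|e |: A| = #|A|.+1 by rewrite cardsU1 eA.
have dA : [disjoint A & B :\ e] by apply: disjointWr dAB; apply: subD1set.
have dA' : [disjoint e |: A & B :\ e].
  by rewrite disjoints_subset subUset sub1set !inE eqxx -disjoints_subset dA.
have rm : r <= #|A| + m by rewrite -ltnS -addnS -Bm.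
have := minor_covectors_delete eB dAB; rewrite cB => /(_ rm).
rewrite (IH A _ cB dA) ?Ar ?cB // (IH _ _ cB dA')
  cA ?cB ?Ar' ?(leq_trans rm) ?leq_add2r //.
rewrite Bm -(subnSK Ar') => h; apply/eqP; rewrite -(eqn_add2r 2) h.
by rewrite uniform_countS.
Qed.

Lemma card_covectors : r <= #|E| -> #|covectors M| = uniform_count r #|E|.
Proof.
move=> rE; have := @card_minor_covectors set0 setT.
rewrite cards0 cardsT subn0 => <- //; last by rewrite -setI_eq0 set0I.
rewrite -(card_imset (covectors M) (f := id)) //; apply: eq_card => Y.
apply/imsetP/minor_covectorsP => [[X hX ->]|[X [hX _ ->]]]; exists X => //.
  by split=> // [f|]; [rewrite inE | apply/ffunP => f; rewrite ffunE inE].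
by apply/ffunP => f; rewrite ffunE inE.
Qed.

End CountingCovectors.

Lemma card_covectors_uniform (r n : nat) (M : oriented_matroid 'I_n) :
  r <= n -> underlying M = uniform_matroid r n ->
  #|covectors M| = uniform_count r n.
Proof.
move=> rn hM.
have flatE (F : {set 'I_n}) : (F \in [set zero_set X | X in covectors M]) =
    (F == setT) || (#|F| < r).
  by have /(congr1 (fun N => F \in flats N)) := hM; rewrite /= [in RHS]inE.
rewrite -[X in uniform_count r X](card_ord n); apply: card_covectors.
- move=> F Fr; have : F \in [set zero_set X | X in covectors M].
    by rewrite flatE Fr orbT.
  by move=> /imsetP[X hX ->]; exists X.
- move=> X hX; have : zero_set X \in [set zero_set X | X in covectors M].
    exact: imset_f.
  rewrite flatE => /orP[/eqP XT _ | lt]; last by rewrite leqNgt lt.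
  by apply/ffunP => e; have := in_setT e; rewrite -XT inE ffunE => /eqP.
by rewrite card_ord.
Qed.

(* Loaded only now, since it shadows many names on finite sets used above. *)
From mathcomp Require Import finmap.
From mathcomp Require Import all_classical all_reals all_analysis.
Import numFieldNormedType.Exports.

Local Open Scope classical_set_scope.
Local Open Scope ring_scope.

(** * Cells of the two representations *)

Lemma f_total_image (I : finType) (T : choiceType) (A : {set I}) (f : I -> T) :
  {in A &, injective f} -> f_total (f @` [set` A]) = #|A|.+1.
Proof.
move=> inj; rewrite /f_total; congr _.+1.
rewrite cardE -(size_map f); apply/perm_size/uniq_perm.
- exact: fset_uniq.
- by rewrite map_inj_in_uniq ?enum_uniq // => x y; rewrite !mem_enum; apply: inj.
have fin : finite_set (f @` [set` A]) by apply: finite_image; apply: finite_finset.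
move=> y; rewrite in_fset_set //; apply/idP/mapP.
  by rewrite inE => -[x xA <-]; exists x; rewrite ?mem_enum.
by move=> [x]; rewrite mem_enum => xA ->; rewrite inE; exists x.
Qed.

Lemma f_total_folkman_lawrence (E : finType) (M : oriented_matroid E) :
  f_total (folkman_lawrence_cells M) = #|covectors M|.
Proof.
rewrite (_ : folkman_lawrence_cells M =
             id @` [set` (covectors M :\ zero_vec E)%SET]); last first.
  apply/seteqP; split=> X /=.
    by move=> [XM X0]; exists X => //; rewrite !inE XM andbT; apply/eqP.
  by move=> [Y]; rewrite !inE => /andP[/eqP Y0 YM] <-.
rewrite f_total_image => [|X Y _ _ //].
by rewrite (cardsD1 (zero_vec E) (covectors M)) covector0 add1n.
Qed.

Section Barycenter.
Variables (R : realType) (V : finType).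

Definition barycenter (s : {set V}) (v : V) : R := (v \in s)%:R / #|s|%:R.

Lemma barycenterP (s : {set V}) : s != finset.set0 -> open_simplex s (barycenter s).
Proof.
rewrite -card_gt0 => s0; have s0' : #|s|%:R != 0 :> R by rewrite pnatr_eq0 -lt0n.
split.
- by move=> v; rewrite divr_ge0 ?ler0n.
- rewrite -mulr_suml -natr_sum (_ : (\sum_i (i \in s) = #|s|)%N) ?divff //.
  by rewrite -sum1_card [RHS]big_mkcond; apply: eq_bigr => i _; case: (i \in s).
apply/setP => v; rewrite inE /barycenter mulf_eq0 invr_eq0 (negPf s0') orbF.
by rewrite pnatr_eq0 eqb0 negbK.
Qed.

Lemma open_simplex_realization (K : {set {set V}}) (s : {set V}) (a : V -> R) :
  s \in K -> open_simplex s a -> realization K a.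
Proof. by move=> sK [a0 a1 as_]; split=> //; rewrite as_. Qed.

Lemma open_simplex_inj (s t : {set V}) (a : V -> R) :
  open_simplex s a -> open_simplex t a -> s = t.
Proof. by move=> [_ _ <-] [_ _ <-]. Qed.

End Barycenter.

Section EngstromCells.
Variables (R : realType) (E : finType) (M : matroid E).

(** The gluing never changes the coordinates, only the summand. *)
Lemma engstrom_equiv_coord (u v : engstrom_point R M) :
  engstrom_equiv u v -> u.1.2 = v.1.2 /\ u.2 = v.2.
Proof.
elim=> [x y [] // | x | x y _ [-> ->] | x y z _ [-> ->] _ [-> ->]] //.
Qed.

Lemma Dfaces_subset (p q : {set E}) : p \subset q ->
  {subset Dfaces M q <= Dfaces M p}.
Proof.
move=> /(corank_subset M) pq e; rewrite !inE => /andP[-> /forall_inP h] /=.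
by apply/forall_inP => v /h vq; apply: leq_trans vq pq.
Qed.

(** The top of [s] is a flat contained in [p], hence of larger corank, so its
summand contains the point with the same coordinates. *)
Lemma engstrom_proj_cover (p : {set E}) (s : {set {set E}})
    (e : {set 'I_(rank M) * bool}) (a : {set E} -> R)
    (x : 'I_(rank M) * bool -> R) :
  p \in flats M -> s \in order_complex (flats_below M p) -> s != finset.set0 ->
  e \in Dfaces M p -> open_simplex s a -> open_simplex e x ->
  engstrom_proj (p, a, x) = engstrom_proj ((finset.cover s, a, x) : engstrom_point R M).
Proof.
move=> hp hs s0 he ha hx.
have [/fintype.subsetP sp sc] := order_complexP _ _ hs.
have hc : finset.cover s \in s := cover_chain hs s0.
have := sp _ hc; rewrite inE => /andP[cflat cp].
have glue : engstrom_glue ((p, a, x) : engstrom_point R M) (finset.cover s, a, x).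
  split=> //=; split=> //=.
  - exact: open_simplex_realization hs ha.
  - exact: open_simplex_realization he hx.
  - apply: open_simplex_realization ha; apply/order_complexP; split=> //.
    apply/fintype.subsetP => F Fs; have := sp _ Fs; rewrite !inE => /andP[-> _] /=.
    exact: (finset.bigcup_sup F).
  - exact: open_simplex_realization (Dfaces_subset cp he) hx.
have eqv := rst_step _ _ _ _ glue.
apply/seteqP; split=> v /= h; last exact: rst_trans eqv h.
exact: rst_trans (rst_sym _ _ _ _ eqv) h.
Qed.

Definition pair_cell (t : {set {set E}} * {set 'I_(rank M) * bool}) :
    set (set (engstrom_point R M)) :=
  @engstrom_proj R E M @` product_cell (finset.cover t.1) t.1 t.2.

Lemma order_complex_below (p : {set E}) (s : {set {set E}}) :
  (s \in order_complex (flats_below M p)) =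
  (s \in order_complex (flats M)) && (finset.cover s \subset p).
Proof.
apply/order_complexP/andP => [[sp sc]|[/order_complexP[sM sc] cp]].
  split; last by apply/finset.bigcupsP => F /(fintype.subsetP sp); rewrite inE => /andP[].
  apply/order_complexP; split=> //; apply: fintype.subset_trans sp _.
  by apply/fintype.subsetP => F; rewrite inE => /andP[].
split=> //; apply/fintype.subsetP => F Fs; rewrite inE (fintype.subsetP sM) //=.
by apply: fintype.subset_trans cp; apply: (finset.bigcup_sup F).
Qed.

Lemma engstrom_cellsE :
  engstrom_cells R M = pair_cell @` [set` cell_pairs M].
Proof.
apply/seteqP; split=> c /=.
  move=> [p [s [e [hp [hs s0] [he e0] ->]]]].
  move: (hs); rewrite order_complex_below => /andP[hsM cp].
  exists (s, e); first by rewrite inE /= hsM s0 (Dfaces_subset cp he).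
  apply/seteqP; split=> _ [[[q a] x] /= [/= -> ha hx] <-].
    by exists (p, a, x) => //; apply: engstrom_proj_cover hx.
  by exists (finset.cover s, a, x) => //; apply/esym; apply: engstrom_proj_cover hx.
move=> [[s e]]; rewrite inE /= => /and4P[hs s0 he e0] <-.
exists (finset.cover s), s, e; split=> //; last first.
  by rewrite order_complex_below hs fintype.subxx.
have [/fintype.subsetP sM _] := order_complexP _ _ hs.
exact: sM (cover_chain hs s0).
Qed.

(** A cell remembers its chain and its face as the supports of the coordinates of
any of its points; barycenters provide a point. *)
Lemma pair_cell_inj : {in cell_pairs M &, injective pair_cell}.
Proof.
move=> [s e] [s' e']; rewrite inE /= => /and4P[_ s0 _ e0] _ eq_cell.
pose u : engstrom_point R M := (finset.cover s, @barycenter R _ s, @barycenter R _ e).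
have hs := barycenterP R s0; have he := barycenterP R e0.
have : pair_cell (s, e) (engstrom_proj u) by exists u.
rewrite eq_cell => -[[[q a] x] /= [/= _ ha hx] eq_proj].
have : engstrom_proj u u by exact: rst_refl.
rewrite -eq_proj => /engstrom_equiv_coord[/= ab xb]; subst a x.
by rewrite (open_simplex_inj hs ha) (open_simplex_inj he hx).
Qed.

Lemma f_total_engstrom : f_total (engstrom_cells R M) = #|cell_pairs M|.+1.
Proof. by rewrite engstrom_cellsE f_total_image //; apply: pair_cell_inj. Qed.

End EngstromCells.

(** * Asymptotics *)

Lemma cvg_eventually_eq (R : realType) (N : nat) (f g : nat -> R) (l : R) :
  (forall n, (N <= n)%N -> f n = g n) -> g @ \oo --> l -> f @ \oo --> l.
Proof.
move=> fg; apply: cvg_trans; apply: near_eq_cvg.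
by exists N => // n /fg.
Qed.

(** After a shift by [j + 1] the ratio is [(j + 1) / (n + 1)]. *)
Lemma cvg_bin_ratioS (R : realType) (j : nat) :
  (fun n => 'C(n, j)%:R / 'C(n, j.+1)%:R : R) @ \oo --> (0 : R).
Proof.
rewrite -(@cvg_shiftn j.+1 R _ (nbhs (0 : R))).
have : (fun n => j.+1%:R * harmonic n) @ \oo --> (j.+1%:R * 0 : R).
  by apply: cvgMl_tmp; exact: cvg_harmonic.
rewrite (mulr0 (j.+1%:R : R)); apply: (@cvg_eventually_eq _ 0) => n _ /=.
have C0 : 'C(n + j.+1, j.+1)%:R != 0 :> R.
  by rewrite pnatr_eq0 -lt0n bin_gt0 leq_addl.
have n0 : n.+1%:R != 0 :> R by rewrite pnatr_eq0.
apply/eqP; rewrite eqr_div // -!natrM; apply/eqP; congr _%:R.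
by rewrite mul_bin_left mulnC; congr (_ * _)%N; lia.
Qed.

Lemma cvg_bin_ratio (R : realType) (j m : nat) : (j <= m)%N ->
  (fun n => 'C(n, j)%:R / 'C(n, m)%:R : R) @ \oo --> ((j == m)%:R : R).
Proof.
move=> /subnK <-; elim: (m - j)%N => [|d IH] /=.
  rewrite add0n eqxx.
  apply: (@cvg_eventually_eq _ j _ (fun=> 1)); last exact: cvg_cst.
  by move=> n jn; rewrite divff // pnatr_eq0 -lt0n bin_gt0.
have /(_ _) := cvgM IH (@cvg_bin_ratioS R (d + j)).
rewrite mulr0 (_ : (j == d.+1 + j)%N = false); last lia.
apply: (@cvg_eventually_eq _ (d + j)) => n jn /=.
by rewrite mulrA divfK // pnatr_eq0 -lt0n bin_gt0.
Qed.

(** Only the leading binomial coefficient counts; the additional [1] is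
['C(n, 0)], which is negligible as [m > 0]. *)
Lemma cvg_bin_sum (R : realType) (t : nat -> nat) (m : nat) : (0 < m)%N ->
  (fun n => (\sum_(k < m.+1) 'C(n, k) * t k).+1%:R / 'C(n, m)%:R : R) @ \oo -->
  ((t m)%:R : R).
Proof.
move=> m0; pose t' k : R := (t k + (k == 0%N))%:R.
have : (fun n => \sum_(k < m.+1) t' k * ('C(n, k)%:R / 'C(n, m)%:R)) @ \oo -->
       \sum_(k < m.+1) t' k * (k == m :> nat)%:R.
  apply: cvg_big => [|k _]; first exact: add_continuous.
  by apply: cvgMl_tmp; apply: cvg_bin_ratio; rewrite -ltnS.
have -> : \sum_(k < m.+1) t' k * (k == m :> nat)%:R = (t m)%:R.
  rewrite big_ord_recr /= eqxx mulr1 big1 ?add0r; last first.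
    by move=> k _; rewrite (ltn_eqF (ltn_ord k)) mulr0.
  by rewrite /t' (gtn_eqF m0) addn0.
apply: (@cvg_eventually_eq _ 0) => n _; rewrite -add1n natrD natr_sum.
rewrite big_ord_recl [RHS]big_ord_recl addrA mulrDl; congr (_ + _).
  by rewrite /t' /= bin0 mul1n natrD addrC div1r.
rewrite mulr_suml; apply: eq_bigr => k _.
by rewrite /t' /= addn0 natrM mulrCA mulrA.
Qed.

Theorem theorem3p9 (R : realType) (r : nat)
    (M : forall n : nat, oriented_matroid 'I_n) (hr : (2 <= r)%N)
    (hM : forall n : nat, (r <= n)%N ->
       underlying (M n) = uniform_matroid r n) :
  (fun n : nat => rho R (M n)) @ \oo -->
    ((fubini (r - 1))%:R / 2%:R ^+ (r - 2) : R).
Proof.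
case: r hr hM => [//|[//|m]] _ hM.
pose t k := ((2 * fubini k - (k == 0)) * (3 ^ (m.+2 - k)).-1)%N.
pose l k := (odd (m.+2 - k) * 2 ^ k.+1)%N.
have tE : t m.+1 = (4 * fubini m.+1)%N.
  by rewrite /t subSnn subn0 mulnAC.
have lE : l m.+1 = (4 * 2 ^ m)%N by rewrite /l subSnn mul1n !expnS mulnA.
have l0 : (l m.+1)%:R != 0 :> R by rewrite lE pnatr_eq0 muln_eq0 expn_eq0.
(* The limit as the ratio of the weights of the leading binomial coefficients. *)
have -> : (fubini (m.+2 - 1))%:R / 2%:R ^+ (m.+2 - 2) =
          (t m.+1)%:R / (l m.+1)%:R :> R.
  by rewrite subn1 subn2 /= tE lE !natrM natrX -mulf_div divff ?mul1r //.
have /(_ _ _) := cvgM (@cvg_bin_sum R t m.+1 isT)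
                      (cvgV l0 (@cvg_bin_sum R l m.+1 isT)).
apply: (@cvg_eventually_eq _ m.+2) => n rn /=.
rewrite /rho f_total_engstrom f_total_folkman_lawrence hM //.
rewrite (card_covectors_uniform rn (hM _ rn)) card_cell_pairs_uniform //.
rewrite invf_div mulrA divfK // pnatr_eq0 -lt0n bin_gt0.
exact: ltnW.
Qed.
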